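(* If $A$ is $1$-Q-Koszul, i.e. $A_0$ is quasi-hereditary with weight poset $\Lambda$ and for all $\lambda,\mu\in\Lambda$ and all $m\in\mathbb Z$, ${\rm ext}^1_A(\Delta^0(\lambda),\nabla_0(\mu)\langle m\rangle)\neq0$ implies $m=1$, then $A$ is tight, i.e. $A$ is generated as an algebra by $A_0$ and $A_1$ (equivalently $A_n=A_1\cdots A_1$ ($n$ factors) for all $n\ge1$).
   Context: Let $k$ be an algebraically closed field and $A=\bigoplus_{i\ge 0}A_i$ a finite-dimensional positively graded $k$-algebra. $A$-grmod is the category of finite-dimensional $\mathbb Z$-graded left $A$-modules; $M\langle r\rangle_i=M_{i-r}$; ${\rm ext}^n_A$ denotes Ext in $A$-grmod. $A_0$-modules are regarded as graded $A$-modules concentrated in grade $0$ via $A\to A/A_{\ge1}\cong A_0$. When $A_0$ is quasi-hereditary with weight poset $\Lambda$, $\Delta^0(\lambda)$ and $\nabla_0(\lambda)$ denote its standard and costandard modules. *)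

(* Defs.v *)
From HB Require Import structures.
From mathcomp Require Import all_boot all_order all_algebra all_field.
Set Implicit Arguments. Unset Strict Implicit. Unset Printing Implicit Defensive.
Import GRing.Theory.
Local Open Scope ring_scope.

(* Conventions:
   - A finite-dimensional k-algebra is an [falgType F]; its grading is a
     family [G : nat -> {vspace A}] of subspaces, G i = A_i.
   - A (finite-dimensional) module M is given by a dimension [n] and an action
     [a |-> ract M a : 'M_n] in ROW-vector convention: a . v := v *m ract M a.
     Hence a left module satisfies ract (a * b) = ract b *m ract a.
   - A graded module additionally carries a degree for each basis vector;
     M_j is spanned by the basis vectors of degree j. *)

Record rep (F : fieldType) (A : Type) := Rep { rdim : nat; ract : A -> 'M[F]_rdim }.
Record grep (F : fieldType) (A : Type) :=
  GRep { gdim : nat; gdeg : 'I_gdim -> int; gact : A -> 'M[F]_gdim }.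

Arguments gdeg {F A} g _.
Arguments GRep {F A} gdim gdeg gact.
Arguments Rep {F A} rdim ract.

Section Defs.
Variables (F : fieldType) (A : falgType F).

Definition pos_graded (G : nat -> {vspace A}) : Prop :=
  (exists N : nat, [/\ forall i, (N <= i)%N -> G i = 0%VS,
                      (\sum_(i < N) G i)%VS = fullv
                    & directv (\sum_(i < N) G i)%VS])
  /\ forall i j, (G i * G j <= G (i + j)%N)%VS.

Definition tight (G : nat -> {vspace A}) : Prop := agenv (G 0%N + G 1%N)%VS = fullv.

Definition is_rep (M : rep F A) : Prop :=
  [/\ forall a b, ract M (a + b) = ract M a + ract M b,
      forall (c : F) a, ract M (c *: a) = c *: ract M a,
      ract M 1 = 1%:M
    & forall a b, ract M (a * b) = ract M b *m ract M a].

(* A_0-modules, viewed as A-modules annihilated by A_{>=1} *)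
Definition is_A0rep (G : nat -> {vspace A}) (M : rep F A) : Prop :=
  is_rep M /\ forall (i : nat) a, (0 < i)%N -> a \in G i -> ract M a = 0.

Definition is_submod (M : rep F A) (U : 'M[F]_(rdim M)) : Prop :=
  forall a, (U *m ract M a <= U)%MS.

Definition is_hom (M N : rep F A) (f : 'M[F]_(rdim M, rdim N)) : Prop :=
  forall a, ract M a *m f = f *m ract N a.

Definition is_iso (M N : rep F A) : Prop :=
  exists f : 'M[F]_(rdim M, rdim N), [/\ is_hom f, row_free f & row_full f].

Definition is_simple (M : rep F A) : Prop :=
  [/\ is_rep M, (0 < rdim M)%N &
      forall U : 'M[F]_(rdim M), is_submod U -> U = 0 \/ row_full U].

(* W/V is isomorphic to L, for submodules V <= W of M *)
Definition iso_sq (M : rep F A) (V W : 'M[F]_(rdim M)) (L : rep F A) : Prop :=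
  exists f : 'M[F]_(rdim M, rdim L),
    [/\ forall a, W *m (ract M a *m f - f *m ract L a) = 0,
        row_full (W *m f)
      & forall v : 'rV[F]_(rdim M), (v <= W)%MS -> (v *m f == 0) = (v <= V)%MS].

(* every composition factor of the subquotient W0/V0 of M is isomorphic to
   some Lf mu with P mu *)
Definition comp_in (Lam : Type) (Lf : Lam -> rep F A) (P : Lam -> Prop)
    (M : rep F A) m0 m1 (V0 : 'M[F]_(m0, rdim M)) (W0 : 'M[F]_(m1, rdim M)) : Prop :=
  forall V W : 'M[F]_(rdim M), is_submod V -> is_submod W ->
    (V0 <= V)%MS -> (V <= W)%MS -> (W <= W0)%MS ->
    forall L : rep F A, is_simple L -> iso_sq V W L ->
    exists mu, P mu /\ is_iso L (Lf mu).

Variable G : nat -> {vspace A}.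

Definition is_proj (P : rep F A) : Prop :=
  forall (X Y : rep F A) (g : 'M[F]_(rdim X, rdim Y)) (h : 'M[F]_(rdim P, rdim Y)),
    is_A0rep G X -> is_A0rep G Y -> is_hom g -> row_full g -> is_hom h ->
    exists l : 'M[F]_(rdim P, rdim X), is_hom l /\ l *m g = h.

Definition is_inj (I : rep F A) : Prop :=
  forall (X Y : rep F A) (g : 'M[F]_(rdim X, rdim Y)) (h : 'M[F]_(rdim X, rdim I)),
    is_A0rep G X -> is_A0rep G Y -> is_hom g -> row_free g -> is_hom h ->
    exists l : 'M[F]_(rdim Y, rdim I), is_hom l /\ g *m l = h.

Definition is_indec (M : rep F A) : Prop :=
  (0 < rdim M)%N /\
  forall U V : 'M[F]_(rdim M), is_submod U -> is_submod V ->
    (U :&: V)%MS == 0 -> row_full (U + V)%MS -> U = 0 \/ V = 0.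

Definition is_pcover (P L : rep F A) : Prop :=
  [/\ is_A0rep G P, is_proj P, is_indec P &
      exists p : 'M[F]_(rdim P, rdim L), is_hom p /\ row_full p].

Definition is_ihull (I L : rep F A) : Prop :=
  [/\ is_A0rep G I, is_inj I, is_indec I &
      exists q : 'M[F]_(rdim L, rdim I), is_hom q /\ row_free q].

Variables (Lam : finType) (le : rel Lam) (Lf : Lam -> rep F A).

Definition lt_w (l m : Lam) : Prop := le l m /\ l <> m.

(* p : P(lam) ->> D exhibits D as the standard module Delta(lam): the largest
   quotient of the projective cover P(lam) of L(lam) whose composition factors
   are all L(mu) with mu <= lam *)
Definition std_quot (lam : Lam) (P D : rep F A) (p : 'M[F]_(rdim P, rdim D)) : Prop :=
  [/\ is_pcover P (Lf lam), is_A0rep G D, is_hom p /\ row_full p,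
      comp_in Lf (fun mu => le mu lam) (kermx p) (1%:M : 'M[F]_(rdim P))
    & forall U : 'M[F]_(rdim P), is_submod U ->
        comp_in Lf (fun mu => le mu lam) U (1%:M : 'M[F]_(rdim P)) ->
        (kermx p <= U)%MS].

Definition is_standard (lam : Lam) (D : rep F A) : Prop :=
  exists (P : rep F A) (p : 'M[F]_(rdim P, rdim D)), std_quot lam p.

(* N is the costandard module nabla(lam): the largest submodule of the
   injective hull I(lam) of L(lam) whose composition factors are all
   L(mu) with mu <= lam *)
Definition is_costandard (lam : Lam) (N : rep F A) : Prop :=
  is_A0rep G N /\
  exists (I : rep F A) (q : 'M[F]_(rdim N, rdim I)),
    [/\ is_ihull I (Lf lam), is_hom q /\ row_free q,
        comp_in Lf (fun mu => le mu lam) (0 : 'M[F]_(rdim I)) q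
      & forall U : 'M[F]_(rdim I), is_submod U ->
          comp_in Lf (fun mu => le mu lam) (0 : 'M[F]_(rdim I)) U ->
          (U <= q)%MS].

Definition is_qh : Prop :=
  [/\ ((forall l, le l l) /\ (forall l m, le l m -> le m l -> l = m)
        /\ (forall l m n, le l m -> le m n -> le l n))
      /\ (forall lam, is_A0rep G (Lf lam) /\ is_simple (Lf lam)),
      forall lam mu, is_iso (Lf lam) (Lf mu) -> lam = mu,
      forall L, is_A0rep G L -> is_simple L -> exists lam, is_iso L (Lf lam),
      (* [Delta(lam) : L(lam)] = 1 *)
      forall lam D, is_standard lam D ->
        forall U : 'M[F]_(rdim D), is_submod U -> ~~ row_full U ->
        comp_in Lf (fun mu => lt_w mu lam) (0 : 'M[F]_(rdim D)) U
    &
      forall lam P D (p : 'M[F]_(rdim P, rdim D)), std_quot lam p ->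
        exists (t : nat) (K : nat -> 'M[F]_(rdim P)) (mus : nat -> Lam),
          [/\ K 0%N = 0, (K t == kermx p)%MS &
              forall j, (j < t)%N ->
                [/\ is_submod (K j.+1), (K j <= K j.+1)%MS, lt_w lam (mus j) &
                    exists Dj, is_standard (mus j) Dj /\ iso_sq (K j) (K j.+1) Dj]]].

Definition is_grep (M : grep F A) : Prop :=
  [/\ forall a b, gact M (a + b) = gact M a + gact M b,
      forall (c : F) a, gact M (c *: a) = c *: gact M a,
      gact M 1 = 1%:M,
      forall a b, gact M (a * b) = gact M b *m gact M a
    & forall (i : nat) a, a \in G i -> forall p q,
        gact M a p q != 0 -> gdeg M q = (gdeg M p + i%:Z)%R].

Definition is_ghom (M N : grep F A) (f : 'M[F]_(gdim M, gdim N)) : Prop :=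
  (forall a, gact M a *m f = f *m gact N a) /\
  (forall p q, f p q != 0 -> gdeg N q = gdeg M p).

(* M<r>, with M<r>_i = M_{i-r} *)
Definition gshift (M : grep F A) (r : int) : grep F A :=
  GRep (gdim M) (fun p => (gdeg M p + r)%R) (gact M).

Definition of_A0 (M : rep F A) : grep F A := GRep (rdim M) (fun _ => 0%R) (ract M).

Definition ext1_ne0 (M N : grep F A) : Prop :=
  exists (E : grep F A) (i : 'M[F]_(gdim N, gdim E)) (p : 'M[F]_(gdim E, gdim M)),
    [/\ is_grep E, is_ghom i /\ is_ghom p, row_free i /\ row_full p,
        (i == kermx p)%MS
      & ~ exists s : 'M[F]_(gdim M, gdim E), is_ghom s /\ s *m p = 1%:M].

End Defs.

(* Main.v *)
Require Import Defs.
From HB Require Import structures.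
From mathcomp Require Import all_boot all_order all_algebra all_field.
From Stdlib Require Import Classical.
Set Implicit Arguments. Unset Strict Implicit. Unset Printing Implicit Defensive.
Import GRing.Theory.
Local Open Scope ring_scope.

(* An extension of an A_0-module M, placed in degree 0, by N<n> with n > 0 is the
   same thing as a cocycle A -> Hom(M, N) living in degree n, and it splits only
   if the cocycle is zero, because splittings preserve degrees.  Suppose that
   A_n is not the sum of the A_i A_{n-i} (0 < i < n) for some n > 1.  Then the
   quotient has a simple quotient L(mu), giving a nonzero A_0-linear map phi
   from A_n to nabla(mu) that kills all these products, and a |-> (x |-> phi(a x))
   is a nonzero cocycle on A_0.  It stays nonzero on an indecomposable summand P
   of A_0, hence on one of the sections of the standard filtration of P, and
   1-Q-Koszulity gives n = 1. *)

(** * Linear algebra: testing on row vectors, subspaces of extremal rank *)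

Lemma mulmx_rVP (F : fieldType) m n (X Y : 'M[F]_(m, n)) :
  (forall v : 'rV_m, v *m X = v *m Y) -> X = Y.
Proof. by move=> eqXY; apply/row_matrixP=> i; rewrite !rowE. Qed.

(** Ranks are bounded by [n], so passing to a witness of larger rank must stop. Since [P] is an
    arbitrary predicate, the existence of such a witness is decided classically. *)
Lemma exists_max_rank (F : fieldType) n (P : 'M[F]_n -> Prop) (W0 : 'M[F]_n) :
  P W0 -> exists2 W, P W & forall W', P W' -> (\rank W' <= \rank W)%N.
Proof.
move: {2}(n - \rank W0)%N (leqnn (n - \rank W0)) => k.
elim: k W0 => [|k IHk] W0 leW0 PW0.
  exists W0 => // W' _; apply: leq_trans (rank_leq_row _) _.
  by rewrite -subn_eq0 -leqn0.
have [[W1 [PW1 ltW1]]|noW] :=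
    classic (exists W1, P W1 /\ (\rank W0 < \rank W1)%N).
  apply: (IHk W1) => //; apply: leq_trans (leq_sub2l n ltW1) _.
  by rewrite subnS; case: (n - _)%N leW0.
exists W0 => // W' PW'; rewrite leqNgt; apply/negP=> lt0.
by apply: noW; exists W'.
Qed.

Lemma exists_min_rank (F : fieldType) n (P : 'M[F]_n -> Prop) (W0 : 'M[F]_n) :
  P W0 -> exists2 W, P W & forall W', P W' -> (\rank W <= \rank W')%N.
Proof.
move: {2}(\rank W0) (leqnn (\rank W0)) => k.
elim: k W0 => [|k IHk] W0 leW0 PW0.
  by exists W0 => // W' _; apply: leq_trans leW0 _.
have [[W1 [PW1 ltW1]]|noW] :=
    classic (exists W1, P W1 /\ (\rank W1 < \rank W0)%N).
  by apply: (IHk W1) => //; rewrite -ltnS (leq_trans ltW1).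
exists W0 => // W' PW'; rewrite leqNgt; apply/negP=> lt0.
by apply: noW; exists W'.
Qed.

(** * Submodules, quotients, simple quotients and direct summands *)

Section Modules.
Variables (F : fieldType) (A : falgType F) (G : nat -> {vspace A}).
Implicit Types M N P Q X Y : rep F A.


Lemma is_hom_comp M N P (f : 'M_(rdim M, rdim N)) (g : 'M_(rdim N, rdim P)) :
  is_hom f -> is_hom g -> is_hom (f *m g).
Proof. by move=> fh gh a; rewrite mulmxA fh -!mulmxA gh. Qed.

Lemma is_hom_pinvmx M N (f : 'M_(rdim M, rdim N)) :
  is_hom f -> row_free f -> row_full f -> is_hom (pinvmx f).
Proof.
move=> fh ffree ffull a.
rewrite -[ract N a]mul1mx -(mulVpmx ffull) -(mulmxA _ f) -fh.
by rewrite -!mulmxA mulmxVp // mulmx1.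
Qed.

Lemma is_iso_sym M N : is_iso M N -> is_iso N M.
Proof.
case=> f [fh ffree ffull]; exists (pinvmx f).
by split; [exact: is_hom_pinvmx | exact: pinvmx_free | exact: pinvmx_full].
Qed.

Lemma is_submod_rV M (U : 'M_(rdim M)) : is_submod U ->
  forall (v : 'rV_(rdim M)) a, (v <= U)%MS -> (v *m ract M a <= U)%MS.
Proof. by move=> Us v a vU; apply: submx_trans (Us a); apply: submxMr. Qed.

Lemma is_submod_ker M N (f : 'M_(rdim M, rdim N)) :
  is_hom f -> is_submod (kermx f).
Proof.
by move=> fh a; apply/sub_kermxP; rewrite -mulmxA fh mulmxA mulmx_ker mul0mx.
Qed.

Lemma is_submod_img M N (f : 'M_(rdim M, rdim N)) (U : 'M_(rdim N)) :
  is_hom f -> (U :=: f)%MS -> is_submod U.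
Proof.
move=> fh Uf a; rewrite (eqmxMr _ Uf) Uf -fh; exact: submxMl.
Qed.

(** [cokermx U] kills exactly the rows lying in [U], so this kernel is the preimage of [U] under
    [f]. *)
Lemma is_submod_preim M N (f : 'M_(rdim M, rdim N)) (U : 'M_(rdim N)) :
  is_hom f -> is_submod U -> is_submod (kermx (f *m cokermx U)).
Proof.
move=> fh Us a; apply/sub_kermxP/eqP; rewrite mulmxA -submxE -mulmxA fh mulmxA.
apply: submx_trans (Us a); apply: submxMr.
by rewrite submxE -mulmxA mulmx_ker.
Qed.

Lemma is_submodI M (U V : 'M_(rdim M)) :
  is_submod U -> is_submod V -> is_submod (U :&: V)%MS.
Proof.
move=> Us Vs a; rewrite sub_capmx.
by rewrite (submx_trans _ (Us a)) ?(submx_trans _ (Vs a)) // submxMr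
   ?capmxSl ?capmxSr.
Qed.

Lemma is_submodD M (U V : 'M_(rdim M)) :
  is_submod U -> is_submod V -> is_submod (U + V)%MS.
Proof. by move=> Us Vs a; rewrite addsmxMr addsmxS. Qed.

Lemma is_submod1 M : is_submod (1%:M : 'M_(rdim M)).
Proof. by move=> a; rewrite submx1. Qed.

Lemma is_submod0 M : is_submod (0 : 'M_(rdim M)).
Proof. by move=> a; rewrite mul0mx sub0mx. Qed.

Lemma is_A0rep_quot M Q (f : 'M_(rdim M, rdim Q)) :
  is_A0rep G M -> is_hom f -> row_full f -> is_A0rep G Q.
Proof.
move=> [[MD MZ M1 MM] M0] fh ffull.
have QE a : ract Q a = pinvmx f *m ract M a *m f.
  by rewrite -mulmxA fh mulmxA mulVpmx // mul1mx.
split; first split.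
- by move=> a b; rewrite !QE MD mulmxDr mulmxDl.
- by move=> c a; rewrite !QE MZ -scalemxAr -scalemxAl.
- by rewrite QE M1 mulmx1 mulVpmx.
- by move=> a b; rewrite [LHS]QE MM -!mulmxA fh (mulmxA (ract M b)) fh !mulmxA mulVpmx // mul1mx.
- by move=> i a i0 aG; rewrite QE (M0 i) // mulmx0 mul0mx.
Qed.

Lemma is_A0rep_sub M N (f : 'M_(rdim N, rdim M)) :
  is_A0rep G M -> is_hom f -> row_free f -> is_A0rep G N.
Proof.
move=> [[MD MZ M1 MM] M0] fh ffree.
have NE a : ract N a = f *m ract M a *m pinvmx f.
  by rewrite -fh mulmxKp.
split; first split.
- by move=> a b; rewrite !NE MD mulmxDr mulmxDl.
- by move=> c a; rewrite !NE MZ -scalemxAr -scalemxAl.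
- by rewrite NE M1 mulmx1 mulmxVp.
- by move=> a b; rewrite [LHS]NE MM (mulmxA f) -fh -(mulmxA (ract N b)) -fh
       (mulmxA (ract N b)) (mulmxKp ffree).
- by move=> i a i0 aG; rewrite NE (M0 i) // mulmx0 mul0mx.
Qed.

Lemma quot_rep M (W : 'M_(rdim M)) : is_submod W ->
  exists Q (f : 'M_(rdim M, rdim Q)),
    [/\ is_hom f, row_full f & (kermx f :=: W)%MS].
Proof.
(* [cokermx W] is square with kernel [W]; its factor [col_base] keeps this kernel but has full
   column rank, so its target has the dimension of the quotient. *)
move=> Ws; pose f := col_base (cokermx W).
have ffull : row_full f by exact: col_base_full.
have kf m (V : 'M_(m, rdim M)) : (V *m f == 0) = (V <= W)%MS.
  have fE : cokermx W = f *m row_base (cokermx W) by rewrite mulmx_base.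
  rewrite submxE [X in _ = (V *m X == 0)]fE mulmxA.
  apply/eqP/eqP=> [->|]; first by rewrite mul0mx.
  by move=> Vf0; rewrite -(mulmxKp (row_base_free (cokermx W)) (V *m f)) Vf0 mul0mx.
(* The action on the quotient: lift linearly, act, project. The choice of lift is harmless because
   [W] is stable. *)
pose Q := Rep (\rank (cokermx W)) (fun a => pinvmx f *m ract M a *m f).
exists Q, f; split=> //.
  move=> a; rewrite /= (mulmxA f) (mulmxA f (pinvmx f)).
  apply/eqP; rewrite -subr_eq0 -mulmxBl kf.
  rewrite -{1}(mul1mx (ract M a)) -mulmxBl.
  apply: submx_trans (Ws a); apply: submxMr.
  by rewrite -kf mulmxBl mul1mx -mulmxA mulVpmx // mulmx1 subrr.
apply/eqmxP/andP; split; first by rewrite -kf mulmx_ker.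
by apply/sub_kermxP/eqP; rewrite kf.
Qed.

Lemma sub_rep M (U : 'M_(rdim M)) : is_submod U ->
  exists N (q : 'M_(rdim N, rdim M)),
    [/\ is_hom q, row_free q & (q :=: U)%MS].
Proof.
move=> Us; pose q := row_base U.
exists (Rep (\rank U) (fun a => q *m ract M a *m pinvmx q)), q.
split; [|exact: row_base_free|exact: eq_row_base].
move=> a; rewrite /= mulmxKpV // eq_row_base.
by apply: submx_trans (Us a); rewrite submxMr // eq_row_base.
Qed.

Lemma simple_quot M (R : 'M_(rdim M)) :
  is_A0rep G M -> is_submod R -> ~~ row_full R ->
  exists Q (f : 'M_(rdim M, rdim Q)),
    [/\ is_A0rep G Q, is_simple Q, is_hom f, row_full f & R *m f = 0].
Proof.
move=> MA Rs Rn.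
(* A proper submodule containing [R] of largest rank is maximal, so its quotient is simple. *)
pose T W := [/\ is_submod W, (R <= W)%MS & ~~ row_full W].
have [W [Ws RW Wn] Wmax] : exists2 W, T W &
    forall W', T W' -> (\rank W' <= \rank W)%N.
  by apply: (@exists_max_rank _ _ T R).
have [Q [f [fh ffull kf]]] := quot_rep Ws.
have QA := is_A0rep_quot MA fh ffull.
exists Q, f; split=> //; last by apply/eqP; rewrite -sub_kermx kf.
split; first by case: QA.
  rewrite lt0n; apply: contra Wn => /eqP Q0.
  rewrite -sub1mx -kf sub_kermx mul1mx; apply/eqP.
  by apply/matrixP=> i [j ltj]; exfalso; move: ltj; rewrite Q0.
(* The preimage [V] of [U] contains [W], so by maximality it is everything or equal to [W]. *)
move=> U Us; pose V := kermx (f *m cokermx U).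
have Vs : is_submod V by exact: is_submod_preim.
have WV : (W <= V)%MS.
  by rewrite -kf sub_kermx mulmxA mulmx_ker mul0mx.
case fullV: (row_full V).
  right; move: fullV; rewrite -sub1mx sub_kermx mul1mx -submxE -!sub1mx => fU.
  by apply: submx_trans fU; rewrite sub1mx.
left; have VW : (V <= W)%MS.
  rewrite -(mxrank_leqif_sup WV).2 eqn_leq mxrankS //=; apply: Wmax.
  by split; rewrite ?fullV // (submx_trans RW).
apply/eqP; rewrite -(mulmxKpV (_ : U <= f)%MS); last exact: submx_full.
rewrite -sub_kermx kf; apply: submx_trans VW; rewrite sub_kermx mulmxA.
by rewrite mulmxKpV ?submx_full // -submxE.
Qed.

Lemma is_hom_proj_mx M (U V : 'M_(rdim M)) :
  is_submod U -> is_submod V -> (U :&: V)%MS = 0 -> row_full (U + V)%MS ->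
  is_hom (proj_mx U V : 'M_(rdim M, rdim M)).
Proof.
move=> Us Vs dxUV UVfull a; apply: mulmx_rVP => v.
have vUV : (v <= U + V)%MS by exact: submx_full.
rewrite 2!(mulmxA v) -{1}(add_proj_mx dxUV vUV) 2!mulmxDl.
rewrite (proj_mx_id dxUV (is_submod_rV Us a (proj_mx_sub U V v))).
by rewrite (proj_mx_0 dxUV (is_submod_rV Vs a (proj_mx_sub V U v))) addr0.
Qed.

Lemma summand M (U V : 'M_(rdim M)) :
  is_submod U -> is_submod V -> (U :&: V)%MS = 0 -> row_full (U + V)%MS ->
  exists N (i : 'M_(rdim N, rdim M)) (p : 'M_(rdim M, rdim N)),
    [/\ is_hom i, is_hom p, i *m p = 1%:M, p *m i = proj_mx U V
      & rdim N = \rank U].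
Proof.
move=> Us Vs dxUV UVfull.
have [N [i [ih ifree iU]]] := sub_rep Us.
have eh := is_hom_proj_mx Us Vs dxUV UVfull.
have iE : i *m proj_mx U V = i by apply: proj_mx_id => //; rewrite iU.
have piE : proj_mx U V *m pinvmx i *m i = proj_mx U V.
  by rewrite mulmxKpV // iU -{1}[proj_mx U V]mul1mx proj_mx_sub.
exists N, i, (proj_mx U V *m pinvmx i); split=> //.
- move=> a; rewrite (mulmxA (ract M a)) eh.
  rewrite -(mulmxKp ifree (proj_mx U V *m pinvmx i *m ract N a)).
  by rewrite -(mulmxA _ (ract N a)) ih (mulmxA _ i) piE.
- by rewrite (mulmxA i) iE mulmxVp.
- by rewrite -iU; apply/esym/eqP.
Qed.

(** [T e] stands for the nonvanishing of something additive in [e]. When a module splits, the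
    identity is a sum of two projections and [T] survives on one of them; repeating this lowers the
    dimension. It serves both to find injective hulls and to find a projective indecomposable on
    which a given cocycle is nonzero. *)
Lemma indec_summand M (T : 'M_(rdim M) -> Prop) :
  (forall e f, T (e + f) -> T e \/ T f) -> ~ T 0 -> T 1%:M ->
  exists N (i : 'M_(rdim N, rdim M)) (p : 'M_(rdim M, rdim N)),
    [/\ is_indec N, is_hom i, is_hom p, i *m p = 1%:M & T (p *m i)].
Proof.
move: {2}(rdim M) (leqnn (rdim M)) => k.
elim: k M T => [|k IHk] M T leM TD T0 T1.
  case: T0; suff <-: 1%:M = 0 :> 'M[F]_(rdim M) by [].
  by apply/matrixP=> -[i lti] j; have := leq_trans lti leM.
have [indM|] := classic (is_indec M).
  exists M, 1%:M, 1%:M; rewrite mulmx1.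
  by split=> // a; rewrite mulmx1 mul1mx.
have M0 : (0 < rdim M)%N.
  rewrite lt0n; apply/eqP=> M0; apply: T0.
  suff <-: 1%:M = 0 :> 'M[F]_(rdim M) by [].
  by apply/matrixP=> -[i lti] j; exfalso; move: lti; rewrite M0.
move=> nindM; have [U [V [Us [Vs [dxUV [UVf [U0 V0]]]]]]] :
    exists U V : 'M_(rdim M), is_submod U /\ is_submod V /\ (U :&: V)%MS = 0 /\
      row_full (U + V)%MS /\ U != 0 /\ V != 0.
  apply: NNPP => no; apply: nindM; split=> // U V Us Vs /eqP dxUV UVf.
  apply: NNPP => /not_or_and[U0 V0]; apply: no; exists U, V.
  by do !split=> //; apply/eqP.
have dxVU : (V :&: U)%MS = 0 by apply/eqP; rewrite -submx0 capmxC dxUV.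
have VUf : row_full (V + U)%MS by rewrite -sub1mx addsmxC sub1mx.
have rk : (\rank U + \rank V)%N = rdim M.
  by rewrite -mxrank_disjoint_sum //; apply/eqP.
have rkU : (\rank U < rdim M)%N.
  by rewrite -[X in (_ < X)%N]rk -[X in (X < _)%N]addn0 ltn_add2l lt0n mxrank_eq0.
have rkV : (\rank V < rdim M)%N.
  by rewrite -[X in (_ < X)%N]rk -[X in (X < _)%N]add0n ltn_add2r lt0n mxrank_eq0.
have : T (proj_mx U V + proj_mx V U).
  suff -> : proj_mx U V + proj_mx V U = 1%:M by [].
  by rewrite -{1}[proj_mx U V]mul1mx -{1}[proj_mx V U]mul1mx add_proj_mx ?submx_full.
suff aux (U' V' : 'M_(rdim M)) : is_submod U' -> is_submod V' ->
    (U' :&: V')%MS = 0 -> row_full (U' + V')%MS -> (\rank U' < rdim M)%N ->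
    T (proj_mx U' V') -> exists N (i : 'M_(rdim N, rdim M)) (p : 'M_(rdim M, rdim N)),
    [/\ is_indec N, is_hom i, is_hom p, i *m p = 1%:M & T (p *m i)].
  by case/TD; apply: aux.
move=> Us' Vs' dxU' U'f rkU' TU'.
have [N [i [p [ih ph ip pi rN]]]] := summand Us' Vs' dxU' U'f.
(* An endomorphism of the summand [N] is extended by zero to [M]. *)
pose T' e := T (p *m e *m i).
have [||||N' [i' [p' [indN' ih' ph' ip' TN']]]] := IHk N T'.
- by rewrite rN -ltnS (leq_trans rkU').
- by move=> e f; rewrite /T' mulmxDr mulmxDl => /TD.
- by rewrite /T' mulmx0 mul0mx.
- by rewrite /T' mulmx1 pi.
exists N', (i' *m i), (p *m p'); split=> //; try exact: is_hom_comp.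
  by rewrite mulmxA -(mulmxA i') ip mulmx1.
by move: TN'; rewrite /T' !mulmxA.
Qed.

Lemma is_proj_retract P Q (i : 'M_(rdim Q, rdim P)) (p : 'M_(rdim P, rdim Q)) :
  is_hom i -> is_hom p -> i *m p = 1%:M -> is_proj G P -> is_proj G Q.
Proof.
move=> ih ph ip Pp X Y g h XA YA gh gf hh.
have [l [lh lg]] := Pp X Y g (p *m h) XA YA gh gf (is_hom_comp ph hh).
exists (i *m l); split; first exact: is_hom_comp.
by rewrite -mulmxA lg mulmxA ip mul1mx.
Qed.

Lemma is_inj_retract P Q (i : 'M_(rdim Q, rdim P)) (p : 'M_(rdim P, rdim Q)) :
  is_hom i -> is_hom p -> i *m p = 1%:M -> is_inj G P -> is_inj G Q.
Proof.
move=> ih ph ip Pp X Y g h XA YA gh gf hh.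
have [l [lh lg]] := Pp X Y g (h *m i) XA YA gh gf (is_hom_comp hh ih).
exists (l *m p); split; first exact: is_hom_comp.
by rewrite mulmxA lg -mulmxA ip mulmx1.
Qed.

Lemma simple_hom_free M N (f : 'M_(rdim M, rdim N)) :
  is_simple M -> is_hom f -> f != 0 -> row_free f.
Proof.
move=> [_ _ Ms] fh f0; rewrite -kermx_eq0.
have [->//|kfull] := Ms _ (is_submod_ker fh).
by case/eqP: f0; apply/eqP; rewrite -[f]mul1mx -sub_kermx submx_full.
Qed.

End Modules.

(** * Composition factors; existence of standard and costandard modules *)

Section CompositionFactors.
Variables (F : fieldType) (A : falgType F).
Implicit Types M N P Q L : rep F A.

Lemma iso_sq_kills M (V W : 'M[F]_(rdim M)) L (f : 'M[F]_(rdim M, rdim L)) :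
  (forall v : 'rV[F]_(rdim M), (v <= W)%MS -> (v *m f == 0) = (v <= V)%MS) ->
  forall m (X : 'M[F]_(m, rdim M)), (X <= W)%MS -> (X *m f == 0) = (X <= V)%MS.
Proof.
move=> kf m X XW; apply/eqP/row_subP=> [Xf0 i|XV].
  by rewrite -kf -?row_mul ?Xf0 ?row0 // (submx_trans (row_sub i X)).
apply/row_matrixP=> i; rewrite row_mul row0; apply/eqP.
by rewrite kf // (submx_trans (row_sub i X)).
Qed.

(** Second isomorphism theorem: as W = V + W', the same [f], restricted to W', induces the
    isomorphism. *)
Lemma iso_sq_capr M (V W W' : 'M[F]_(rdim M)) L :
  (V <= W)%MS -> (W' <= W)%MS -> (W <= V + W')%MS ->
  iso_sq V W L -> iso_sq (V :&: W')%MS W' L.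
Proof.
move=> VW W'W WVW' [f [fh ffull kf]]; exists f; split.
- by move=> a; case/submxP: W'W => D ->; rewrite -mulmxA fh mulmx0.
- rewrite -sub1mx; move: ffull; rewrite -sub1mx => /submx_trans; apply.
  apply: submx_trans (submxMr f WVW') _; rewrite addsmxMr addsmx_sub submx_refl.
  have /eqP -> : V *m f == 0 by rewrite (iso_sq_kills kf).
  by rewrite sub0mx.
- by move=> v vW'; rewrite (kf _ (submx_trans vW' W'W)) sub_capmx vW' andbT.
Qed.

(** Second isomorphism theorem in the other direction. Here [f] has to be modified so that it
    vanishes on [Z] without changing on [W]. *)
Lemma iso_sq_addsr M (V W Z : 'M[F]_(rdim M)) L :
  is_submod W -> is_submod Z -> (V <= W)%MS -> (W :&: Z <= V)%MS ->
  iso_sq V W L -> iso_sq (V + Z)%MS (W + Z)%MS L.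
Proof.
move=> Ws Zs VW WZV [f [fh ffull kf]].
have dx : ((W :\: Z) :&: Z)%MS = 0 by exact: capmx_diff.
have [f' f'Z f'W] : exists2 f' : 'M[F]_(rdim M, rdim L),
    (forall m (z : 'M[F]_(m, rdim M)), (z <= Z)%MS -> z *m f' = 0) &
    (forall m (w : 'M[F]_(m, rdim M)), (w <= W)%MS -> w *m f' = w *m f).
  (* First project along [Z] onto a complement of [W :&: Z] in [W]. This moves a vector of [W] only
     by an element of [W :&: Z], hence of [V], which [f] kills. *)
  exists (proj_mx (W :\: Z)%MS Z *m f) => m x.
    by move=> xZ; rewrite mulmxA (proj_mx_0 dx xZ) mul0mx.
  move=> xW; have xWZ : (x <= (W :\: Z) + Z)%MS.
    move: xW; rewrite -(addsmx_diff_cap_eq W Z) => /submx_trans; apply.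
    by rewrite addsmxS ?capmxSr.
  rewrite (mulmxA x); apply/eqP; rewrite -subr_eq0 -mulmxBl.
  have dW : (x *m proj_mx (W :\: Z)%MS Z - x <= W)%MS.
    rewrite addmx_sub ?eqmx_opp //.
    exact: submx_trans (proj_mx_sub _ _ _) (diffmxSl _ _).
  rewrite (iso_sq_kills kf dW); apply: submx_trans WZV.
  by rewrite sub_capmx dW -opprB eqmx_opp proj_mx_compl_sub.
exists f'; split.
- move=> a; apply: mulmx_rVP => v; rewrite mulmx0 mulmxA.
  have /sub_addsmxP[[D E] /= ->] : (v *m (W + Z)%MS <= W + Z)%MS by exact: submxMl.
  set w := D *m W; set z := E *m Z.
  have wW : (w <= W)%MS by exact: submxMl.
  have zZ : (z <= Z)%MS by exact: submxMl.
  rewrite mulmxBr !mulmxA !mulmxDl.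
  rewrite (f'Z _ _ (is_submod_rV Zs a zZ)) (f'Z _ _ zZ).
  rewrite (f'W _ _ (is_submod_rV Ws a wW)) (f'W _ _ wW) mul0mx !addr0.
  by rewrite -!mulmxA -!mulmxBr fh mulmx0.
- rewrite -sub1mx; move: ffull; rewrite -sub1mx => /submx_trans; apply.
  by rewrite addsmxMr f'W // addsmxSl.
- move=> u /sub_addsmxP[[D E] /= ->]; set w := D *m W; set z := E *m Z.
  have wW : (w <= W)%MS by exact: submxMl.
  have zZ : (z <= Z)%MS by exact: submxMl.
  rewrite mulmxDl (f'Z _ _ zZ) (f'W _ _ wW) addr0 kf //; apply/idP/idP=> [wV|].
    by rewrite addmx_sub_adds.
  case/sub_addsmxP=> -[D' E'] /= wz; rewrite -kf // -f'W //.
  have -> : w = D' *m V + E' *m Z - z by rewrite -wz addrK.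
  have DW : (D' *m V <= W)%MS by apply: submx_trans (submxMl _ _) VW.
  rewrite mulmxBl mulmxDl (f'Z _ _ (submxMl E' Z)) (f'Z _ _ zZ) (f'W _ _ DW).
  by rewrite addr0 subr0 (iso_sq_kills kf DW) submxMl.
Qed.

Lemma iso_sq_simple M (V W X : 'M[F]_(rdim M)) L :
  is_simple L -> iso_sq V W L -> is_submod X ->
  (V <= X)%MS -> (X <= W)%MS -> (X <= V)%MS \/ (W <= X)%MS.
Proof.
move=> [_ _ Ls] [f [fh ffull kf]] Xs VX XW.
have XfS : is_submod (<<X *m f>>%MS : 'M[F]_(rdim L)).
  move=> a; rewrite genmxE (eqmxMr _ (genmxE _)) -mulmxA.
  suff -> : X *m (f *m ract L a) = X *m ract M a *m f by rewrite submxMr.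
  apply/eqP; rewrite eq_sym -subr_eq0 -!mulmxA -mulmxBr.
  by case/submxP: XW => D ->; rewrite -mulmxA fh mulmx0.
have [Xf0|Xfull] := Ls _ XfS.
  left; rewrite -(iso_sq_kills kf) //; apply/eqP.
  by apply/eqP; rewrite -submx0 -[X in (_ <= X)%MS]Xf0 genmxE.
right; have /submxP[D WfE] : (W *m f <= X *m f)%MS.
  by rewrite -(genmxE (X *m f)) submx_full.
have WD : (W - D *m X <= V)%MS.
  rewrite -(iso_sq_kills kf) ?mulmxBl ?WfE ?mulmxA ?subrr //.
  by rewrite addmx_sub // eqmx_opp (submx_trans (submxMl _ _)).
by rewrite -(subrK (D *m X) W) addmx_sub ?submxMl ?(submx_trans WD).
Qed.

(** A simple section is visible either modulo [U] or inside [U]: the submodule V + (W ∩ U) between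
    [V] and [W] must be one of the two. The alternatives are the hypotheses of [iso_sq_addsr] and
    [iso_sq_capr]. *)
Lemma iso_sq_cap_dichotomy M (V W U : 'M[F]_(rdim M)) L :
  is_submod V -> is_submod W -> is_submod U -> (V <= W)%MS ->
  is_simple L -> iso_sq V W L ->
  (W :&: U <= V)%MS \/ (W <= V + (W :&: U))%MS.
Proof.
move=> Vs Ws Us VW Ls VWL.
have [|||sub|sub] := @iso_sq_simple _ V W (V + (W :&: U))%MS L Ls VWL.
- by apply: is_submodD => //; apply: is_submodI.
- exact: addsmxSl.
- by rewrite addsmx_sub VW capmxSl.
- by left; apply: submx_trans sub; exact: addsmxSr.
- by right.
Qed.

Lemma iso_sq_neq0 M (V W : 'M[F]_(rdim M)) L :
  is_simple L -> iso_sq V W L -> (V <= W)%MS -> ~~ (W <= V)%MS.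
Proof.
move=> [_ L0 _] [f [_ ffull kf]] VW; rewrite -(iso_sq_kills kf) //.
apply: contraL ffull => /eqP ->.
by rewrite /row_full mxrank0 eq_sym -lt0n.
Qed.

Section CompIn.
Variables (Lam : Type) (Lf : Lam -> rep F A) (T : Lam -> Prop).

(** A simple section above U ∩ U' either survives modulo [U], or comes from U/(U ∩ U'), which is
    isomorphic to (U + U')/U'. Closure under intersection gives a least such submodule, hence a
    largest quotient. *)
Lemma comp_in_capmx M (U U' : 'M[F]_(rdim M)) :
  is_submod U -> is_submod U' ->
  comp_in Lf T U (1%:M : 'M[F]_(rdim M)) -> comp_in Lf T U' (1%:M : 'M[F]_(rdim M)) ->
  comp_in Lf T (U :&: U')%MS (1%:M : 'M[F]_(rdim M)).
Proof.
move=> Us Us' cU cU' V W Vs Ws UV VW _ L Ls VWL.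
have [WU|WU] := iso_sq_cap_dichotomy Vs Ws Us VW Ls VWL.
  apply: (cU (V + U)%MS (W + U)%MS); rewrite ?addsmxSr ?submx1 ?addsmxS //.
  - exact: is_submodD.
  - exact: is_submodD.
  - exact: iso_sq_addsr.
have WUs := is_submodI Ws Us.
have sq := iso_sq_capr VW (capmxSl _ _) WU VWL.
apply: (cU' (V :&: (W :&: U) + U')%MS ((W :&: U) + U')%MS);
  rewrite ?addsmxSr ?submx1 ?addsmxS ?capmxSr //.
- by apply: is_submodD => //; apply: is_submodI.
- exact: is_submodD.
- apply: iso_sq_addsr => //; first exact: capmxSr.
  rewrite sub_capmx capmxSl andbT; apply: submx_trans UV.
  by rewrite capmxS ?capmxSr.
Qed.

(** Dually, a simple section of U + U' lies in [U] or in (U + U')/U, which is a quotient of U'. *)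
Lemma comp_in_addsmx M (U U' : 'M[F]_(rdim M)) :
  is_submod U -> is_submod U' ->
  comp_in Lf T (0 : 'M[F]_(rdim M)) U -> comp_in Lf T (0 : 'M[F]_(rdim M)) U' ->
  comp_in Lf T (0 : 'M[F]_(rdim M)) (U + U')%MS.
Proof.
move=> Us Us' cU cU' V W Vs Ws _ VW WUU' L Ls VWL.
have [WU|WU] := iso_sq_cap_dichotomy Vs Ws Us VW Ls VWL; last first.
  have sq := iso_sq_capr VW (capmxSl _ _) WU VWL.
  apply: (cU (V :&: (W :&: U))%MS (W :&: U)%MS); rewrite ?sub0mx ?capmxSr //.
  - by apply: is_submodI => //; apply: is_submodI.
  - exact: is_submodI.
have sq := iso_sq_addsr Ws Us VW WU VWL.
have VUs := is_submodD Vs Us; have WUs := is_submodD Ws Us.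
(* The part of U' lying over (W + U)/U; by the modular law U + W' is all of W + U. *)
pose W' := (U' :&: (W + U))%MS.
have sW' : is_submod W' by exact: is_submodI.
apply: (cU' ((V + U) :&: W')%MS W'); rewrite ?sub0mx ?capmxSr ?capmxSl //.
  exact: is_submodI.
apply: iso_sq_capr sq; [by rewrite addsmxS | exact: capmxSr |].
have UW' : (U + W' <= V + U + W')%MS by rewrite addsmxS ?addsmxSr.
apply: submx_trans UW'.
rewrite (matrix_modl _ (addsmxSr W U)) sub_capmx submx_refl andbT.
by rewrite addsmx_sub WUU' addsmxSl.
Qed.

Lemma comp_in_eqV M m m' (U : 'M[F]_(m, rdim M)) (U' : 'M[F]_(m', rdim M))
    m1 (W0 : 'M[F]_(m1, rdim M)) :
  (U <= U')%MS -> comp_in Lf T U W0 -> comp_in Lf T U' W0.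
Proof.
move=> UU' cU V W Vs Ws U'V; apply: cU => //; exact: submx_trans U'V.
Qed.

Lemma comp_in_eqW M m m' m1 (V0 : 'M[F]_(m1, rdim M))
    (U : 'M[F]_(m, rdim M)) (U' : 'M[F]_(m', rdim M)) :
  (U' <= U)%MS -> comp_in Lf T V0 U -> comp_in Lf T V0 U'.
Proof.
move=> UU' cU V W Vs Ws V0V VW WU'; apply: cU => //; exact: submx_trans UU'.
Qed.

Lemma comp_in_trivial M (U : 'M[F]_(rdim M)) : comp_in Lf T U U.
Proof.
move=> V W _ _ UV VW WU L Ls VWL.
by have := iso_sq_neq0 Ls VWL VW; rewrite (submx_trans WU).
Qed.

(** A submodule of the image of a simple module is zero or the whole image, so the only simple
    section is the image itself. *)
Lemma comp_in_simple_img mu M (q : 'M[F]_(rdim (Lf mu), rdim M)) :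
  is_simple (Lf mu) -> is_hom q -> row_free q -> T mu ->
  comp_in Lf T (0 : 'M[F]_(rdim M)) q.
Proof.
move=> Lmus qh qfree Tmu V W Vs Ws _ VW Wq L Ls VWL.
have neqVW := iso_sq_neq0 Ls VWL VW.
have sub01 (X : 'M[F]_(rdim M)) : is_submod X -> (X <= q)%MS ->
    X = 0 \/ (q <= X)%MS.
  move=> Xs /submxP[D XE]; case: Lmus => _ _ Lmus.
  have [k0|kfull] := Lmus _ (is_submod_preim qh Xs).
    left; rewrite XE; apply/eqP.
    suff /eqP -> : D == 0 by rewrite mul0mx.
    by rewrite -submx0 -k0 sub_kermx mulmxA -XE -submxE.
  by right; move: kfull; rewrite -sub1mx sub_kermx mul1mx -submxE.
have qW : (q <= W)%MS.
  have [W0|//] := sub01 W Ws Wq.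
  by move: neqVW; rewrite W0 sub0mx.
have V0 : V = 0.
  have [//|qV] := sub01 V Vs (submx_trans VW Wq).
  by move: neqVW; rewrite (submx_trans Wq).
exists mu; split=> //; apply: is_iso_sym.
case: VWL => f [fh ffull kf]; exists (q *m f); split.
- move=> a; rewrite mulmxA qh -!mulmxA; apply/eqP; rewrite -subr_eq0 -mulmxBr.
  by case/submxP: qW => D ->; rewrite -mulmxA fh mulmx0.
- have kq : kermx (q *m f) *m q = 0.
    apply/eqP; rewrite -submx0 -V0 -(iso_sq_kills kf).
      by rewrite -mulmxA mulmx_ker.
    exact: submx_trans (submxMl _ _) qW.
  by rewrite -kermx_eq0 -(mulmxKp qfree (kermx _)) kq mul0mx.
- by rewrite -sub1mx; move: ffull; rewrite -sub1mx => /submx_trans; apply; rewrite submxMr.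
Qed.

End CompIn.

Variables (G : nat -> {vspace A}) (Lam : finType) (le : rel Lam).
Variable Lf : Lam -> rep F A.

(** An admissible kernel of least rank lies in every other one, because intersecting the two cannot
    lower the rank. *)
Lemma std_quot_exists lam P : is_pcover G P (Lf lam) ->
  exists D (p : 'M[F]_(rdim P, rdim D)), std_quot G le Lf lam p.
Proof.
move=> Pc; have PA : is_A0rep G P by case: Pc.
pose T U := is_submod U /\
  comp_in Lf (fun mu => le mu lam) U (1%:M : 'M[F]_(rdim P)).
have [U [Us cU] Umin] : exists2 U, T U &
    forall U', T U' -> (\rank U <= \rank U')%N.
  apply: (@exists_min_rank _ _ T 1%:M).
  by split; [exact: is_submod1 | exact: comp_in_trivial].
have [D [p [ph pfull kp]]] := quot_rep Us.
exists D, p; split=> //; first exact: is_A0rep_quot pfull.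
  by apply: comp_in_eqV cU; rewrite kp.
move=> U' Us' cU'; rewrite kp; apply: submx_trans (capmxSr U U').
rewrite -(mxrank_leqif_sup (capmxSl U U')).2 eqn_leq mxrankS ?capmxSl //=.
by apply: Umin; split; [exact: is_submodI | exact: comp_in_capmx].
Qed.

(** Dual to [std_quot_exists], with sums and largest rank. The embedding of the simple module is
    recorded too, since it later makes a map into the costandard module nonzero. *)
Lemma costandard_exists mu I :
  is_simple (Lf mu) -> le mu mu -> is_ihull G I (Lf mu) ->
  exists N (e : 'M[F]_(rdim (Lf mu), rdim N)),
    [/\ is_costandard G le Lf mu N, is_hom e & row_free e].
Proof.
move=> Ls lemm Ih; have [IA _ _ [q0 [q0h q0free]]] := Ih.
pose T U := is_submod U /\
  comp_in Lf (fun m => le m mu) (0 : 'M[F]_(rdim I)) U.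
have [U [Us cU] Umax] : exists2 U, T U &
    forall U', T U' -> (\rank U' <= \rank U)%N.
  apply: (@exists_max_rank _ _ T 0).
  by split; [exact: is_submod0 | exact: comp_in_trivial].
have Ubig U' : T U' -> (U' <= U)%MS.
  move=> [Us' cU']; apply: submx_trans (addsmxSr U U') _.
  rewrite -(mxrank_leqif_sup (addsmxSl U U')).2 eqn_leq mxrankS ?addsmxSl //=.
  by apply: Umax; split; [exact: is_submodD | exact: comp_in_addsmx].
have [N [q [qh qfree qU]]] := sub_rep Us.
(* Reflexivity of the order makes the image of L(mu) one of the submodules collected in [U]. *)
have q0q : (q0 <= q)%MS.
  rewrite qU -(genmxE q0); apply: Ubig; split.
    by apply: is_submod_img q0h _; exact: genmxE.
  have := @comp_in_simple_img _ _ (fun m => le m mu) _ _ _ Ls q0h q0free lemm.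
  by apply: comp_in_eqW; rewrite genmxE.
exists N, (q0 *m pinvmx q); split.
- split; first exact: is_A0rep_sub qfree.
  exists I, q; split=> //.
    by apply: comp_in_eqW cU; rewrite qU.
  by move=> U' Us' cU'; rewrite qU; apply: Ubig.
- move=> a; rewrite -[LHS](mulmxKp qfree) -[RHS](mulmxKp qfree); congr (_ *m _).
  by rewrite -(mulmxA (ract _ a)) mulmxKpV // q0h -mulmxA qh (mulmxA _ q) mulmxKpV.
- rewrite -row_leq_rank; move: q0free; rewrite -row_leq_rank => /leq_trans; apply.
  by rewrite -{1}(mulmxKpV q0q) mxrankM_maxl.
Qed.

End CompositionFactors.

(** * Cocycles and first extensions of graded modules *)

Section Cocycles.
Variables (F : fieldType) (A : falgType F) (G : nat -> {vspace A}).
Implicit Types M N P D : rep F A.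

(* Extensions of M by N<n> with n > 0: the underlying graded space is M (+) N
   canonically, so the module structure is determined by its off-diagonal
   component, and the extension splits exactly when that component vanishes. *)
Definition cocycle M N (n : nat) (d : A -> 'M[F]_(rdim M, rdim N)) : Prop :=
  [/\ forall a b, d (a + b) = d a + d b,
      forall (c : F) a, d (c *: a) = c *: d a,
      forall a b, d (a * b) = ract M b *m d a + d b *m ract N a
    & forall i a, a \in G i -> i != n -> d a = 0].

Lemma ext1_cocycle M N n (d : A -> 'M[F]_(rdim M, rdim N)) a0 :
  is_A0rep G M -> is_A0rep G N -> (0 < n)%N ->
  cocycle n d -> d a0 != 0 ->
  ext1_ne0 G (of_A0 M) (gshift (of_A0 N) n%:Z).
Proof.
move=> [[MD MZ M1 MM] M0] [[ND NZ N1 NM] N0] n0 [dD dZ dM d0] da0.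
have n0' : n%:Z != 0 by rewrite eqz_nat -lt0n.
(* [M] sits in degree 0 and [N] in degree [n]. Vectors are rows, so [N] is the submodule of the last
   coordinates and [d] is the upper right block. *)
pose deg := row_mx (const_mx 0) (const_mx n%:Z) : 'rV[int]_(rdim M + rdim N).
pose E := GRep (rdim M + rdim N) (fun i => deg 0 i)
  (fun a => block_mx (ract M a) (d a) 0 (ract N a)).
exists E, (row_mx 0 1%:M), (col_mx 1%:M 0); split.
- split=> /=.
  + by move=> a b; rewrite add_block_mx MD ND dD addr0.
  + by move=> c a; rewrite scale_block_mx MZ NZ dZ scaler0.
  + have -> : d 1 = 0.
      have := dM 1 1; rewrite mulr1 M1 N1 mul1mx mulmx1 => /eqP.
      by rewrite -subr_eq subrr => /eqP.
    by rewrite M1 N1 -scalar_mx_block.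
  + by move=> a b; rewrite mulmx_block !mul0mx !mulmx0 !addr0 add0r MM NM dM.
  + move=> i a aG p q.
    case: (split_ordP p) => p' ->; case: (split_ordP q) => q' ->;
      rewrite ?block_mxEul ?block_mxEur ?block_mxEdl ?block_mxEdr /deg
              ?row_mxEl ?row_mxEr ?mxE.
    * by case: i aG => [|i] aG; rewrite ?addr0 // (M0 i.+1) // mxE eqxx.
    * have [->|neq] := eqVneq i n; first by rewrite add0r.
      by rewrite (d0 i) // mxE eqxx.
    * by rewrite eqxx.
    * by case: i aG => [|i] aG; rewrite ?addr0 // (N0 i.+1) // mxE eqxx.
- split; split=> /=.
  + by move=> a; rewrite mul_row_block mul_mx_row !mulmx0 !mul0mx !add0r mul1mx mulmx1.
  + move=> p q; case: (split_ordP q) => q' ->; rewrite /deg ?row_mxEl ?row_mxEr.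
      by rewrite mxE eqxx.
    by rewrite [const_mx _ _ _]mxE add0r.
  + by move=> a; rewrite mul_block_col mul_col_mx !mulmx0 !mul0mx !addr0 mul1mx mulmx1.
  + move=> p q; case: (split_ordP p) => p' ->; rewrite /deg ?col_mxEu ?col_mxEd.
      by rewrite row_mxEl [const_mx _ _ _]mxE.
    by rewrite mxE eqxx.
- split.
  + apply/row_freeP; exists (col_mx 0 1%:M).
    by rewrite mul_row_col mul0mx mul1mx add0r.
  + apply/row_fullP; exists (row_mx 1%:M 0).
    by rewrite mul_row_col mul0mx mul1mx addr0.
- apply/andP; split.
    by apply/sub_kermxP; rewrite mul_row_col mul0mx mulmx0 addr0.
  set K := kermx _; have : K *m col_mx 1%:M 0 = 0 by exact: mulmx_ker.
  rewrite -[K]hsubmxK mul_row_col mulmx1 mulmx0 addr0 => ->.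
  by apply/submxP; exists (rsubmx K); rewrite mul_mx_row mulmx0 mulmx1.
- case=> s [[sh sdeg] sp]; move/eqP: da0; apply.
  (* A graded splitting has no component from degree 0 to degree [n], so [s] is the inclusion of the
     first summand; compatibility with the action then forces [d] to vanish. *)
  have rs0 : rsubmx s = 0.
    apply/matrixP=> i j; rewrite !mxE; apply/eqP/negPn/negP => /sdeg /=.
    by rewrite /deg row_mxEr mxE => /eqP; rewrite (negPf n0').
  have sE : s = row_mx 1%:M 0.
    move: sp; rewrite -[s]hsubmxK rs0 mul_row_col mulmx1 mulmx0 addr0 => ls.
    by rewrite ls.
  have := sh a0; rewrite /= sE mul_mx_row mul_row_block !mulmx0 !mul0mx !mul1mx mulmx1.
  by rewrite !addr0 => /eq_row_mx[_ <-].
Qed.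

(* Vanishing of all cocycles is inherited along extensions in the first
   argument: a cocycle on W that is zero on V factors through W / V. *)
Lemma cocycle_iso_sq P N n (d : A -> 'M[F]_(rdim P, rdim N))
    D (V W : 'M[F]_(rdim P)) :
  cocycle n d -> is_submod W -> (V <= W)%MS -> iso_sq V W D ->
  (forall d' : A -> 'M[F]_(rdim D, rdim N),
     cocycle n d' -> forall a, d' a = 0) ->
  (forall a, V *m d a = 0) -> forall a, W *m d a = 0.
Proof.
move=> [dD dZ dM d0] Ws VW [f [fh ffull kf]] Dvan Vd0.
have [s sWf] : exists s, s *m (W *m f) = 1%:M by exact/row_fullP.
(* [s] is only a linear section, but two lifts to [W] of one vector of [D] differ by an element of
   [V], where [d] vanishes. So d' is independent of the lift and inherits the cocycle identity. *)
pose d' a := s *m W *m d a.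
have d'E m (X : 'M_(m, rdim P)) a : (X <= W)%MS -> X *m f *m d' a = X *m d a.
  move=> XW; have dW : (X - X *m f *m s *m W <= W)%MS.
    by rewrite addmx_sub // eqmx_opp submxMl.
  have : (X - X *m f *m s *m W <= V)%MS.
    rewrite -(iso_sq_kills kf dW) mulmxBl -!mulmxA sWf.
    by rewrite mulmx1 subrr.
  case/submxP=> C XE; apply/eqP; rewrite eq_sym -subr_eq0 /d' !mulmxA -mulmxBl.
  by rewrite XE -mulmxA Vd0 mulmx0.
have cd' : cocycle n d'.
  split.
  - by move=> a b; rewrite /d' dD mulmxDr.
  - by move=> c a; rewrite /d' dZ -scalemxAr.
  - move=> a b; rewrite /d' dM mulmxDr !mulmxA; congr (_ + _).
    rewrite -d'E; last first.
      by rewrite -mulmxA; apply: submx_trans (submxMl _ _) (Ws b).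
    have /eqP : W *m (ract P b *m f - f *m ract D b) = 0 by exact: fh.
    rewrite mulmxBr subr_eq0 !mulmxA => /eqP WbE.
    have -> : s *m W *m ract P b *m f = ract D b.
      by rewrite -!(mulmxA s) WbE (mulmxA s) sWf mul1mx.
    by [].
  - by move=> i a aG ni; rewrite /d' (d0 i) // mulmx0.
by move=> a; rewrite -d'E // Dvan // mulmx0.
Qed.

End Cocycles.

(** * Coordinates on subspaces of the algebra *)

Section Coordinates.
Variables (F : fieldType) (A : vectType F).
Implicit Types U W : {vspace A}.

(** [elt] and [coo] translate between subspaces of [A] and the row vectors on which modules act.
    [coo U] is linear on all of [A], but inverts [elt] only on [U]. *)
Definition elt U (v : 'rV[F]_(\dim U)) : A := \sum_i v 0 i *: (vbasis U)`_i.
Definition coo U (a : A) : 'rV[F]_(\dim U) := \row_i coord (vbasis U) i a.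

Lemma elt_mem U (v : 'rV_(\dim U)) : elt v \in U.
Proof.
by apply: memv_suml => i _; rewrite memvZ // vbasis_mem // mem_nth ?size_tuple.
Qed.

Lemma eltK U (v : 'rV_(\dim U)) : coo U (elt v) = v.
Proof.
by apply/rowP=> i; rewrite mxE coord_sum_free // (basis_free (vbasisP U)).
Qed.

Lemma cooK U a : a \in U -> elt (coo U a) = a.
Proof.
move=> aU; rewrite [RHS](coord_vbasis aU).
by apply: eq_bigr => i _; rewrite mxE.
Qed.

Lemma elt_linear U : linear (@elt U).
Proof.
move=> c u v; rewrite /elt scaler_sumr -big_split.
by apply: eq_bigr => i _; rewrite !mxE scalerDl scalerA.
Qed.
HB.instance Definition _ U := GRing.isLinear.Build F _ _ _ (@elt U) (@elt_linear U).

Lemma coo_linear U : linear (coo U).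
Proof. by move=> c a b; apply/rowP=> i; rewrite !mxE linearP. Qed.
HB.instance Definition _ U := GRing.isLinear.Build F _ _ _ (coo U) (@coo_linear U).

Lemma mx_of_subspace U W : (W <= U)%VS ->
  exists R : 'M[F]_(\dim U), forall v : 'rV_(\dim U), (v <= R)%MS = (elt v \in W).
Proof.
move=> WU; pose X := \matrix_(i < \dim W) coo U (vbasis W)`_i.
have XE (c : 'rV_(\dim W)) : c *m X = coo U (elt c).
  rewrite mulmx_sum_row [elt c]/elt linear_sum.
  by apply: eq_bigr => i _; rewrite rowK linearZ.
exists <<X>>%MS => v; rewrite genmxE; apply/submxP/idP=> [[c ->]|vW].
  by rewrite XE cooK ?(subvP WU) ?elt_mem.
by exists (coo W (elt v)); rewrite XE cooK // eltK.
Qed.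

End Coordinates.

Lemma mul_lin1 (F : fieldType) m n (f : 'rV[F]_m -> 'rV[F]_n) (v : 'rV_m) :
  linear f -> v *m lin1_mx f = f v.
Proof.
move=> flin.
pose f' : {linear 'rV[F]_m -> 'rV[F]_n} :=
  HB.pack f (GRing.isLinear.Build F _ _ _ f flin).
exact: (mul_rV_lin1 f').
Qed.

(** * The A_0-modules A_n, the dual of A_0, injective hulls, and the cocycle of a map on A_n *)

Section Graded.
Variables (F : fieldType) (A : falgType F) (G : nat -> {vspace A}).
Variables (N0 : nat) (pr : nat -> 'End(A)).
Hypothesis pr_mem : forall i a, pr i a \in G i.
Hypothesis pr_id : forall i a, a \in G i -> pr i a = a.
Hypothesis pr_0 : forall i j a, a \in G i -> j != i -> pr j a = 0.
Hypothesis pr_sum : forall a, a = \sum_(i < N0) pr i a.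
Hypothesis mulG : forall i j a b,
  a \in G i -> b \in G j -> a * b \in G (i + j)%N.

Lemma homogeneous_ind (T : A -> Prop) :
  T 0 -> (forall a b, T a -> T b -> T (a + b)) ->
  (forall i a, a \in G i -> T a) -> forall a, T a.
Proof.
move=> T0 TD Th a; rewrite (pr_sum a).
by apply: big_ind => // i _; apply: Th (pr_mem i a).
Qed.

Lemma mulG0 a b : a \in G 0%N -> b \in G 0%N -> a * b \in G 0%N.
Proof. exact: mulG. Qed.

(** A homogeneous component of [c] of positive degree moves [a] out of degree [i]. *)
Lemma pr_mull i c a : a \in G i -> pr i (c * a) = pr 0 c * a.
Proof.
move=> ai; elim/homogeneous_ind: c => [|c c' IHc IHc'|j c cj].
- by rewrite mul0r !linear0 mul0r.
- by rewrite mulrDl !linearD /= IHc IHc' mulrDl.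
have [j0|j0] := eqVneq j 0%N.
  by rewrite j0 in cj; rewrite (pr_id cj) pr_id // -[i]add0n mulG.
rewrite (pr_0 (mulG cj ai)) ?(pr_0 cj) 1?eq_sym ?mul0r //.
by rewrite -{2}[i]add0n eqn_add2r.
Qed.

(** By [pr_mull], [pr 0 1] is a left identity on homogeneous elements, hence on all of [A], and so
    it equals 1. *)
Lemma one_G0 : 1 \in G 0%N.
Proof.
suff <- : pr 0 1 = 1 by exact: pr_mem.
rewrite -[LHS]mulr1; elim/homogeneous_ind: {2 3}(1 : A) => [|a b IHa IHb|i a ai].
- by rewrite mulr0.
- by rewrite mulrDr IHa IHb.
- by rewrite -(pr_mull 1 ai) mul1r pr_id.
Qed.

Lemma pr_mulr n b a : b \in G 0%N -> pr n (b * a) = b * pr n a.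
Proof.
move=> b0; elim/homogeneous_ind: a => [|a a' IHa IHa'|j a aj].
- by rewrite mulr0 !linear0 mulr0.
- by rewrite mulrDr !linearD /= IHa IHa' mulrDr.
have baj : b * a \in G j by rewrite -[j]add0n mulG.
have [->|nj] := eqVneq n j; first by rewrite !pr_id.
by rewrite (pr_0 baj) // (pr_0 aj) // mulr0.
Qed.

(** [pr 0] is the quotient map from [A] to A/A_{>=1}, identified with A_0: a product with a
    homogeneous factor of positive degree has no component in degree 0. *)
Lemma pr0M a b : pr 0 (a * b) = pr 0 a * pr 0 b.
Proof.
elim/homogeneous_ind: b => [|b b' IHb IHb'|j b bj].
- by rewrite mulr0 !linear0 mulr0.
- by rewrite mulrDr !linearD /= IHb IHb' mulrDr.
have [j0|j0] := eqVneq j 0%N.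
  by rewrite j0 in bj; rewrite pr_mull // (pr_id bj).
rewrite (pr_0 bj) 1?eq_sym // mulr0.
elim/homogeneous_ind: a => [|a a' IHa IHa'|i a ai].
- by rewrite mul0r linear0.
- by rewrite mulrDl linearD /= IHa IHa' addr0.
by rewrite (pr_0 (mulG ai bj)) // eq_sym addn_eq0 negb_and j0 orbT.
Qed.

Lemma ract_pr0 (X : rep F A) a : is_A0rep G X -> ract X (pr 0 a) = ract X a.
Proof.
move=> [[XD XZ _ _] X0]; have XZ0 : ract X 0 = 0.
  by rewrite -[0 in LHS](scale0r 0) XZ scale0r.
elim/homogeneous_ind: a => [|a a' IHa IHa'|i a ai].
- by rewrite linear0.
- by rewrite linearD /= !XD IHa IHa'.
have [i0|i0] := eqVneq i 0%N; first by rewrite i0 in ai; rewrite pr_id.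
by rewrite (pr_0 ai) 1?eq_sym // XZ0 (X0 i) // lt0n.
Qed.

(** Left multiplication by A_0, inflated to [A] along [pr 0]; it is a module when [U] is stable
    under A_0, as each A_n is. *)
Definition lrep (U : {vspace A}) : rep F A :=
  Rep (\dim U) (fun a => lin1_mx (fun v => coo U (pr 0 a * elt v))).

Lemma lrepE U (v : 'rV_(\dim U)) a :
  v *m ract (lrep U) a = coo U (pr 0 a * elt v).
Proof.
rewrite mul_lin1 // => c u w.
by rewrite !linearP /= mulrDr -scalerAr linearP.
Qed.

Lemma lrep_A0rep (U : {vspace A}) :
  (forall a b, a \in G 0%N -> b \in U -> a * b \in U) -> is_A0rep G (lrep U).
Proof.
move=> GU; split; first split.
- move=> a b; apply: mulmx_rVP => v; rewrite mulmxDr !lrepE.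
  by rewrite linearD /= mulrDl linearD.
- move=> c a; apply: mulmx_rVP => v; rewrite -scalemxAr !lrepE.
  by rewrite linearZ /= -scalerAl linearZ.
- by apply: mulmx_rVP => v; rewrite lrepE mulmx1 (pr_id one_G0) mul1r eltK.
- move=> a b; apply: mulmx_rVP => v; rewrite mulmxA !lrepE pr0M cooK ?mulrA //.
  by rewrite GU ?elt_mem ?pr_mem.
- move=> i a i0 ai; apply: mulmx_rVP => v; rewrite lrepE (pr_0 ai) ?mul0r ?linear0 ?mulmx0 //.
  by rewrite eq_sym -lt0n.
Qed.

Lemma lrep_G_A0rep n : is_A0rep G (lrep (G n)).
Proof. by apply: lrep_A0rep => a b aG bG; rewrite -[n]add0n mulG. Qed.

(** A_0 is free on 1: lift the image of 1 along [g] and let A_0 act on the lift. *)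
Lemma lrep_proj : is_proj G (lrep (G 0%N)).
Proof.
move=> X Y g h XA YA gh gfull hh.
have [[XD XZ X1 XM] _] := XA.
pose y := coo (G 0%N) 1 *m h; pose x := y *m pinvmx g.
have xg : x *m g = y by rewrite mulmxKpV // submx_full.
pose l : 'M[F]_(\dim (G 0%N), rdim X) := lin1_mx (fun v => x *m ract X (elt v)).
have lE v : v *m l = x *m ract X (elt v).
  rewrite mul_lin1 // => c u w.
  by rewrite linearP XD XZ mulmxDr -scalemxAr.
exists l; split.
  move=> a; apply: mulmx_rVP => v; rewrite !mulmxA lrepE !lE cooK; last first.
    by rewrite mulG0 ?pr_mem ?elt_mem.
  by rewrite XM mulmxA ract_pr0.
apply: mulmx_rVP => v; rewrite mulmxA lE -mulmxA gh mulmxA xg /y -mulmxA.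
rewrite -(hh (elt v)) mulmxA lrepE cooK ?one_G0 // mulr1.
by rewrite (pr_id (elt_mem v)) eltK.
Qed.

(* The linear dual of A_0, in the basis dual to vbasis (G 0). *)
Definition corep : rep F A :=
  Rep (\dim (G 0%N))
    (fun a => (lin1_mx (fun v => coo (G 0%N) (elt v * pr 0 a)))^T).

Lemma mulmx_tr_rVP m n (X Y : 'M[F]_(m, n)) :
  (forall v : 'rV_n, X *m v^T = Y *m v^T) -> X = Y.
Proof.
move=> eqXY; apply: trmx_inj; apply: mulmx_rVP => v.
by apply: trmx_inj; rewrite !trmx_mul !trmxK.
Qed.

(** Functionals on A_0 are rows, so elements of A_0 appear as columns; right multiplication on them
    gives a left action on functionals. *)
Lemma corepE (v : 'rV_(\dim (G 0%N))) a :
  ract corep a *m v^T = (coo (G 0%N) (elt v * pr 0 a))^T.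
Proof.
rewrite -trmx_mul mul_lin1 // => c u w.
by rewrite linearP mulrDl -scalerAl linearP.
Qed.

Lemma corep_A0rep : is_A0rep G corep.
Proof.
split; first split.
- move=> a b; apply: mulmx_tr_rVP => v; rewrite mulmxDl !corepE.
  by rewrite linearD /= mulrDr !linearD.
- move=> c a; apply: mulmx_tr_rVP => v; rewrite -scalemxAl !corepE.
  by rewrite linearZ /= -scalerAr !linearZ.
- by apply: mulmx_tr_rVP => v; rewrite corepE mul1mx (pr_id one_G0) mulr1 eltK.
- move=> a b; apply: mulmx_tr_rVP => v; rewrite -mulmxA !corepE pr0M cooK ?mulrA //.
  by rewrite mulG0 ?elt_mem ?pr_mem.
- move=> i a i0 ai; apply: mulmx_tr_rVP => v; rewrite corepE (pr_0 ai).
    by rewrite mulr0 linear0 trmx0 mul0mx.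
  by rewrite eq_sym -lt0n.
Qed.

(** Maps from [Y] to the dual of A_0 correspond to functionals on [Y]: [k] gives the map sending y
    to the functional v ↦ k(v y). *)
Lemma functional_hom Y (k : 'cV[F]_(rdim Y)) : is_A0rep G Y ->
  exists l : 'M[F]_(rdim Y, rdim corep), is_hom l /\
    forall v : 'rV_(\dim (G 0%N)), l *m v^T = ract Y (elt v) *m k.
Proof.
move=> YA; have [[YD YZ Y1 YM] _] := YA.
pose l : 'M[F]_(rdim Y, \dim (G 0%N)) :=
  (lin1_mx (fun v : 'rV_(\dim (G 0%N)) => (ract Y (elt v) *m k)^T))^T.
have lE v : l *m v^T = ract Y (elt v) *m k.
  rewrite -trmx_mul mul_lin1 ?trmxK // => c u w.
  by rewrite linearP YD YZ mulmxDl -scalemxAl linearP.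
exists l; split=> // a; apply: mulmx_tr_rVP => v.
rewrite -!mulmxA corepE !lE cooK; last by rewrite mulG0 ?elt_mem ?pr_mem.
by rewrite YM ract_pr0 // mulmxA.
Qed.

(** By this correspondence it suffices to extend a functional linearly along the injective [g],
    which [pinvmx g] does. The functional attached to [h] is its evaluation at 1, the column [c]. *)
Lemma corep_inj : is_inj G corep.
Proof.
move=> X Y g h XA YA gh gfree hh.
pose c := (coo (G 0%N) 1)^T.
have [l [lh lE]] := functional_hom (pinvmx g *m (h *m c)) YA.
exists l; split=> //; apply: mulmx_tr_rVP => v.
rewrite -mulmxA lE mulmxA -gh -mulmxA (mulmxA g) mulmxVp // mul1mx mulmxA hh.
rewrite -mulmxA corepE cooK ?one_G0 // mul1r (pr_id (elt_mem v)).
by rewrite eltK.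
Qed.

Lemma ihull_exists L : is_A0rep G L -> is_simple L -> exists I, is_ihull G I L.
Proof.
move=> LA Ls; have L0 : (0 < rdim L)%N by case: Ls.
(* Any nonzero functional would do: it yields a nonzero map from [L] to the dual of A_0, and some
   indecomposable summand receives a nonzero component, injective as [L] is simple. *)
pose k : 'cV[F]_(rdim L) := const_mx 1.
have k0 : k != 0.
  apply/eqP=> /matrixP/(_ (Ordinal L0) 0); rewrite !mxE => /eqP.
  by rewrite oner_eq0.
have [q [qh qE]] := functional_hom k LA.
have q0 : q != 0.
  apply: contra k0 => /eqP q0; move: (qE (coo (G 0%N) 1)).
  rewrite q0 mul0mx cooK ?one_G0 //; case: LA => [[_ _ -> _] _].
  by rewrite mul1mx => <-.
have [|||I [i [p [indI ih ph ip qpi]]]] :=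
    @indec_summand _ _ corep (fun e => q *m e != 0).
- move=> e f; rewrite mulmxDr; have [->|] := eqVneq (q *m e) 0; last by left.
  by rewrite add0r; right.
- by rewrite mulmx0 eqxx.
- by rewrite mulmx1.
exists I; split=> //.
- have ifree : row_free i by apply/row_freeP; exists p.
  exact: is_A0rep_sub corep_A0rep ih ifree.
- exact: is_inj_retract ih ph ip corep_inj.
have qph := is_hom_comp qh ph.
exists (q *m p); split=> //; apply: simple_hom_free => //.
by apply: contra qpi => /eqP qp0; rewrite mulmxA qp0 mul0mx.
Qed.

(** The degree-[n] part of the square of the ideal A_{>=1}. *)
Definition decomposables n : {vspace A} :=
  (\sum_(i < n | (0 < i)%N) G i * G (n - i))%VS.

Lemma decomposables_mul n i j a b : (0 < i)%N -> (0 < j)%N -> (i + j)%N = n ->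
  a \in G i -> b \in G j -> a * b \in decomposables n.
Proof.
move=> i0 j0 ijn ai bj; have lti : (i < n)%N by rewrite -ijn -{1}[i]addn0 ltn_add2l.
have sub := @sumv_sup _ _ _ (Ordinal lti) (fun i : 'I_n => (0 < i)%N)
  (G i * G (n - i))%VS (fun i : 'I_n => G i * G (n - i))%VS i0 (subvv _).
by apply: (subvP sub); rewrite memv_mul // -ijn addKn.
Qed.

Lemma decomposables_sub n : (decomposables n <= G n)%VS.
Proof.
apply/subv_sumP=> i i0; apply/prodvP=> a b ai bj.
by rewrite -(subnKC (ltnW (ltn_ord i))) mulG.
Qed.

Lemma decomposables_G0 n a b :
  a \in G 0%N -> b \in decomposables n -> a * b \in decomposables n.
Proof.
move=> a0 /memv_sumP[u uG ->]; rewrite mulr_sumr; apply: memv_sumr => i i0.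
have : (G 0%N * (G i * G (n - i)) <= G i * G (n - i))%VS.
  rewrite prodvA prodvSl //; apply/prodvP=> x y x0 yi.
  by rewrite -[nat_of_ord i]add0n mulG.
by move/subvP; apply; rewrite memv_mul // uG.
Qed.

Lemma indecomposable_cocycle n N (f : 'M[F]_(\dim (G n), rdim N)) :
  (0 < n)%N -> is_A0rep G N -> @is_hom _ _ (lrep (G n)) N f -> f != 0 ->
  (forall a, a \in decomposables n -> coo (G n) a *m f = 0) ->
  exists d : A -> 'M[F]_(\dim (G 0%N), rdim N),
    @cocycle _ _ G (lrep (G 0%N)) N n d /\ exists a, d a != 0.
Proof.
move=> n0 NA fh f0 fdec.
(* [f] extended to [A] by zero in the degrees other than [n]. *)
pose phi a := coo (G n) (pr n a) *m f.
have phiD a b : phi (a + b) = phi a + phi b.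
  by rewrite /phi !linearD /= mulmxDl.
have phiZ c a : phi (c *: a) = c *: phi a.
  by rewrite /phi !linearZ /= -scalemxAl.
have phi0 : phi 0 = 0 by rewrite /phi !linear0 mul0mx.
have phi_act a b : phi (pr 0 a * b) = phi b *m ract N a.
  rewrite /phi -mulmxA -fh mulmxA lrepE cooK ?pr_mem //.
  by rewrite pr_mulr ?pr_mem.
(* This is the cocycle identity in disguise. If both degrees are 0, every term vanishes as n > 0; if
   exactly one is 0, one term on the right remains; if both are positive, the product is
   decomposable or not of degree [n]. *)
have phi_prod a b : phi (a * b) = phi (a * pr 0 b) + phi (pr 0 a * b).
  elim/homogeneous_ind: a => [|a a' IHa IHa'|i a ai].
  - by rewrite linear0 !mul0r phi0 addr0.
  - by rewrite linearD /= !mulrDl !phiD IHa IHa' addrACA.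
  elim/homogeneous_ind: b => [|b b' IHb IHb'|j b bj].
  - by rewrite linear0 !mulr0 phi0 addr0.
  - by rewrite linearD /= !mulrDr !phiD IHb IHb' addrACA.
  have [i0|i0] := eqVneq i 0%N; have [j0|j0] := eqVneq j 0%N.
  - rewrite i0 in ai; rewrite j0 in bj; rewrite !pr_id //.
    suff -> : phi (a * b) = 0 by rewrite addr0.
    have ab0 : a * b \in G 0%N by rewrite mulG0.
    by rewrite /phi (pr_0 ab0) -?lt0n // linear0 mul0mx.
  - rewrite i0 in ai; rewrite (pr_id ai) (pr_0 bj) 1?eq_sym //.
    by rewrite mulr0 phi0 add0r.
  - rewrite j0 in bj; rewrite (pr_id bj) (pr_0 ai) 1?eq_sym //.
    by rewrite mul0r phi0 addr0.
  - rewrite (pr_0 ai) 1?eq_sym // (pr_0 bj) 1?eq_sym // mul0r mulr0 phi0 addr0.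
    have [ijn|ijn] := eqVneq n (i + j)%N.
      rewrite /phi pr_id; last by rewrite ijn mulG.
      apply: fdec.
      by apply: (@decomposables_mul n i j); rewrite ?lt0n.
    by rewrite /phi (pr_0 (mulG ai bj)) // linear0 mul0mx.
pose d a : 'M[F]_(\dim (G 0%N), rdim N) := lin1_mx (fun v => phi (a * elt v)).
have dE a v : v *m d a = phi (a * elt v).
  rewrite mul_lin1 // => c u w.
  by rewrite linearP mulrDr -scalerAr phiD phiZ.
exists d; split; first split.
- move=> a b; apply: mulmx_rVP => v; rewrite mulmxDr !dE.
  by rewrite mulrDl phiD.
- move=> c a; apply: mulmx_rVP => v; rewrite -scalemxAr !dE.
  by rewrite -scalerAl phiZ.
- move=> a b; apply: mulmx_rVP => v; rewrite mulmxDr !mulmxA lrepE !dE.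
  rewrite cooK; last by rewrite mulG0 ?pr_mem ?elt_mem.
  by rewrite -mulrA phi_prod phi_act pr0M (pr_id (elt_mem v)).
- move=> i a ai ni; apply: mulmx_rVP => v; rewrite dE mulmx0.
  have av : a * elt v \in G i by rewrite -[i]addn0 mulG ?elt_mem.
  by rewrite /phi (pr_0 av) 1?eq_sym // linear0 mul0mx.
(* Evaluating [d a] at 1 returns [phi a], so [d] determines [f]. *)
apply: NNPP => nd; case/eqP: f0; apply: mulmx_rVP => v; rewrite mulmx0.
have := dE (elt v) (coo (G 0%N) 1); rewrite cooK ?one_G0 // mulr1.
rewrite /phi (pr_id (elt_mem v)) eltK => <-.
suff -> : d (elt v) = 0 by rewrite mulmx0.
by apply/eqP/negPn/negP=> dv; apply: nd; exists (elt v).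
Qed.

End Graded.

(** * Degree projections, generation in degrees 0 and 1, standard filtrations and the conclusion *)

Lemma graded_projections (F : fieldType) (A : falgType F) (G : nat -> {vspace A}) :
  pos_graded G -> exists (N : nat) (pr : nat -> 'End(A)),
    [/\ forall i a, pr i a \in G i,
        forall i a, a \in G i -> pr i a = a,
        forall i j a, a \in G i -> j != i -> pr j a = 0
      & forall a, a = \sum_(i < N) pr i a].
Proof.
move=> [[N [GN0 Gfull Gdx]] _].
pose prI (i : 'I_N) : 'End(A) := sumv_pi_for (esym Gfull) i.
(* From degree [N] on the projection is 0, in accordance with the vanishing of [G i] there. *)
pose pr i : 'End(A) := if insub i is Some j then prI j else 0.
have prE (j : 'I_N) : pr j = prI j by rewrite /pr valK.
have pr_mem i a : pr i a \in G i.
  rewrite /pr; case: insubP => [j _ <-|_]; first exact: memv_sum_pi.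
  by rewrite lfunE mem0v.
have pr_sum a : a = \sum_(i < N) pr i a.
  rewrite -{1}(sumv_pi_sum (esym Gfull) (memvf a)).
  by apply: eq_bigr => i _; rewrite prE.
have hom i j a : a \in G i -> pr j a = if j == i then a else 0.
  move=> ai; have [ltj|leNj] := ltnP j N; last first.
    have := pr_mem j a; rewrite GN0 // memv0 => /eqP ->.
    case: eqP => // ji; move: ai; rewrite -ji GN0 // memv0.
    by move/eqP.
  have [lti|leNi] := ltnP i N; last first.
    move: ai; rewrite GN0 // memv0 => /eqP ->.
    by rewrite linear0 if_same.
  (* Two homogeneous decompositions of [a] are compared: its projections, and [a] alone in degree
     [i]. *)
  pose u (k : 'I_N) := pr k a.
  pose v (k : 'I_N) := if k == i :> nat then a else 0.
  have vG (k : 'I_N) : true -> v k \in G k.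
    by rewrite /v; case: eqP => [->//|_ _]; exact: mem0v.
  have := directv_sum_unique Gdx u v (fun k _ => pr_mem k a) vG.
  rewrite -pr_sum (bigD1 (Ordinal lti)) //= {1}/v eqxx big1 ?addr0 ?eqxx.
    by move/esym/forallP/(_ (Ordinal ltj))/eqP.
  by move=> k /negPf; rewrite -val_eqE /v /= => ->.
exists N, pr; split=> //.
- by move=> i a ai; rewrite (hom i) // eqxx.
- by move=> i j a ai /negPf ji; rewrite (hom i) // ji.
Qed.

(** Strong induction on the degree: both factors of a product in [decomposables G n] have degree
    less than [n]. *)
Lemma decomposables_tight (F : fieldType) (A : falgType F) (G : nat -> {vspace A}) :
  pos_graded G ->
  (forall n, (1 < n)%N -> (G n <= decomposables G n)%VS) -> tight G.
Proof.
move=> [[N [_ Gfull _]] _] dec; pose B := agenv (G 0%N + G 1%N)%VS.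
have GB n : (G n <= B)%VS.
  elim/ltn_ind: n => -[|[|n]] IHn.
  - exact: subv_trans (addvSl _ _) (sub_agenv _).
  - exact: subv_trans (addvSr _ _) (sub_agenv _).
  apply: subv_trans (dec n.+2 isT) _; apply/subv_sumP=> i i0.
  rewrite /B -agenvM prodvS ?IHn // ltn_subrL i0 //.
apply/eqP; rewrite -[agenv _]/B eqEsubv subvf /= -Gfull; apply/subv_sumP=> i _; exact: GB.
Qed.

(** Every section of the filtration of [kermx p], and the top section [D], is standard, so
    [cocycle_iso_sq] carries the vanishing from 0 up to [P] one section at a time. *)
Lemma std_filtration_cocycle (F : fieldType) (A : falgType F)
    (G : nat -> {vspace A}) (Lam : finType) (le : rel Lam) (L : Lam -> rep F A)
    lam (P D N : rep F A) (p : 'M[F]_(rdim P, rdim D)) n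
    (d : A -> 'M[F]_(rdim P, rdim N)) :
  is_qh G le L -> std_quot G le L lam p -> cocycle G n d ->
  (forall mu D', is_standard G le L mu D' ->
     forall d' : A -> 'M[F]_(rdim D', rdim N), cocycle G n d' ->
     forall a, d' a = 0) ->
  forall a, d a = 0.
Proof.
move=> [_ _ _ _ qhfilt] stdp cd van.
have [t [K [mus [K0 Kt Kstep]]]] := qhfilt _ _ _ _ stdp.
have Kd j : (j <= t)%N -> forall a, K j *m d a = 0.
  elim: j => [|j IHj] ltjt; first by move=> a; rewrite K0 mul0mx.
  have [Ks KK _ [Dj [stdDj sq]]] := Kstep j ltjt.
  by apply: (cocycle_iso_sq cd Ks KK sq (van _ _ stdDj)); apply: IHj (ltnW _).
have kd a : kermx p *m d a = 0.
  by case/andP: Kt => _ /submxP[C ->]; rewrite -mulmxA Kd ?mulmx0.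
move=> a; rewrite -[d a]mul1mx; move: a.
have stdD : is_standard G le L lam D by exists P, p.
apply: (cocycle_iso_sq cd (@is_submod1 _ _ P) (submx1 _) _ (van _ _ stdD) kd).
case: stdp => _ _ [ph pfull] _ _; exists p; split.
- by move=> a; rewrite ph subrr mulmx0.
- by rewrite mul1mx.
- by move=> v _; rewrite sub_kermx.
Qed.

Theorem theorem2p2 (F : closedFieldType) (A : falgType F)
    (G : nat -> {vspace A}) (Lam : finType) (le : rel Lam) (L : Lam -> rep F A) :
  pos_graded G ->
  is_qh G le L ->
  (forall (lam mu : Lam) (D N : rep F A) (m : int),
     is_standard G le L lam D -> is_costandard G le L mu N ->
     ext1_ne0 G (of_A0 D) (gshift (of_A0 N) m) -> m = 1) ->
  tight G.
Proof.
move=> Gr qh ext1; apply: decomposables_tight => // n n1.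
have [[[lerefl _] LA0s] _ Lexh _ _] := qh.
have mulG i j a b : a \in G i -> b \in G j -> a * b \in G (i + j)%N.
  by case: Gr => _ GM ai bj; apply: (subvP (GM i j)); exact: memv_mul.
have [N0 [pr [pr_mem pr_id pr_0 pr_sum]]] := graded_projections Gr.
have n0 : (0 < n)%N by exact: ltnW.
apply/negPn/negP=> ndec.
have MA := lrep_G_A0rep pr_mem pr_id pr_0 pr_sum mulG n.
(* [R] is the space of decomposables in coordinates on A_n: a submodule, and by assumption a proper
   one. *)
have [R RE] := mx_of_subspace (decomposables_sub mulG n).
have Rs : @is_submod _ _ (lrep pr (G n)) R.
  move=> a; apply/row_subP=> i; rewrite row_mul RE lrepE cooK.
    by rewrite decomposables_G0 // -RE row_sub.
  by apply: (mulG 0%N n) => //; exact: elt_mem.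
have Rn : ~~ row_full R.
  apply: contra ndec => Rfull; apply/subvP=> a an.
  by rewrite -(cooK an) -RE submx_full.
have [Q [f [QA Qs fh ffull Rf0]]] := simple_quot MA Rs Rn.
have [mu [g [gh gfree gfull]]] := Lexh Q QA Qs.
have [LA Ls] := LA0s mu.
have [I Ih] := ihull_exists pr_mem pr_id pr_0 pr_sum mulG LA Ls.
have [N [e [Ncost eh efree]]] := costandard_exists Ls (lerefl mu) Ih.
have NA : is_A0rep G N by case: Ncost.
(* The composite from A_n through its simple quotient L(mu) into the costandard module [N]. *)
have fgeh := is_hom_comp (is_hom_comp fh gh) eh.
have fge0 : f *m g *m e != 0.
  apply: contraL ffull => /eqP fge0.
  have f0 : f = 0.
    by rewrite -(mulmxKp gfree f) -(mulmxKp efree (f *m g)) fge0 !mul0mx.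
  rewrite f0 /row_full mxrank0 eq_sym -lt0n.
  by case: Qs.
have [|d [cd [a0 da0]]] :=
    indecomposable_cocycle pr_mem pr_id pr_0 pr_sum mulG n0 NA fgeh fge0.
  move=> a adec; have aG := subvP (decomposables_sub mulG n) _ adec.
  have /submxP[C ->] : (coo (G n) a <= R)%MS by rewrite RE cooK.
  by rewrite -!mulmxA (mulmxA R) Rf0 !mul0mx mulmx0.
have BA := lrep_G_A0rep pr_mem pr_id pr_0 pr_sum mulG 0.
have [|||P [i [p [indP ih ph ip [a1 da1]]]]] :=
    @indec_summand _ _ (lrep pr (G 0%N)) (fun e => exists a, e *m d a != 0).
- move=> e1 e2 [a]; rewrite mulmxDl.
  have [->|e1a] := eqVneq (e1 *m d a) 0; last by left; exists a.
  by rewrite add0r; right; exists a.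
- by case=> a; rewrite mul0mx eqxx.
- by exists a0; rewrite mul1mx.
have ifree : row_free i by apply/row_freeP; exists p.
have PA := is_A0rep_sub BA ih ifree.
(* A simple quotient of [P] supplies the weight [lam] for which [P] is a projective cover. *)
have P0 : ~~ row_full (0 : 'M[F]_(rdim P)).
  by rewrite /row_full mxrank0 eq_sym -lt0n; case: indP.
have [Q' [f' [QA' Qs' fh' ffull' _]]] := simple_quot PA (@is_submod0 _ _ P) P0.
have [lam [g' [gh' gfree' gfull']]] := Lexh Q' QA' Qs'.
have Pc : is_pcover G P (L lam).
  split=> //.
    exact: is_proj_retract ih ph ip (lrep_proj pr_mem pr_id pr_0 pr_sum mulG).
  exists (f' *m g'); split; first exact: is_hom_comp.
  by rewrite -sub1mx (submx_trans _ (submxMr g' (_ : 1%:M <= f')%MS)) ?mul1mx ?sub1mx.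
have [D [p' stdp]] := std_quot_exists le Pc.
pose dP a := i *m d a.
have cdP : cocycle G n dP.
  case: cd => dD dZ dM d0; split.
  - by move=> a b; rewrite /dP dD mulmxDr.
  - by move=> c a; rewrite /dP dZ -scalemxAr.
  - by move=> a b; rewrite /dP dM mulmxDr mulmxA -ih !mulmxA.
  - by move=> j a aj jn; rewrite /dP (d0 j) // mulmx0.
have dP0 : forall a, dP a = 0.
  (* A nonzero cocycle on a standard module would give a nonsplit extension with shift [n], so n =
     1, against n > 1. *)
  apply: (std_filtration_cocycle qh stdp cdP) => nu D' stdD' d' cd' a.
  apply/eqP/negPn/negP=> d'a.
  have DA' : is_A0rep G D' by case: stdD' => ? [? []].
  have /eqP := ext1 _ _ _ _ _ stdD' Ncost (ext1_cocycle DA' NA n0 cd' d'a).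
  by rewrite eqz_nat => /eqP nE; move: n1; rewrite nE.
by move: da1; rewrite -mulmxA -/(dP a1) dP0 mulmx0 eqxx.
Qed.
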